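(* Let $G$ be a nontrivial finite abelian group (written additively) with subgroups $G_1,\ldots,G_n$ such that $\bigcap_{i=1}^n G_i=\{0\}$, and let $C$ be the quasi-uniform code generated by $G$ and $G_1,\ldots,G_n$. Then the minimum distance of $C$, $\min_{c\in C,\,c\ne 0} wt(c)$, is equal to $$n-\max_{\mathcal{A}\subseteq\mathcal{N},\ G_{\mathcal{A}}\neq\{0\}}|\mathcal{A}|.$$
   Context: Let $n\ge 1$ and $\mathcal{N}=\{1,\ldots,n\}$. For $\mathcal{A}\subseteq\mathcal{N}$ put $G_{\mathcal{A}}=\bigcap_{i\in\mathcal{A}}G_i$, with $G_{\emptyset}=G$. For each $i$ let $\pi_i: G\to G/G_i$ be the canonical projection and $\psi_i:G/G_i\to H_i$ a group isomorphism onto an abelian group $H_i$. The quasi-uniform code generated by $G$ and $G_1,\ldots,G_n$ is $C=\{(\psi_1(\pi_1(g)),\ldots,\psi_n(\pi_n(g))): g\in G\}\subseteq H_1\times\cdots\times H_n$. The weight $wt(c)$ of a word $c$ is the number of its components $c_i$ that are not the identity element $0$ of $H_i$; $0$ also denotes the all-zero word. The minimum distance of $C$ is the minimum, over pairs $c\neq c'$ in $C$, of $|\{i: c_i\ne c_i'\}|$. *)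

(* Defs.v *)
From mathcomp Require Import all_boot all_fingroup.

Set Implicit Arguments.
Unset Strict Implicit.
Unset Printing Implicit Defensive.

Local Open Scope group_scope.

(* Abelian groups are written multiplicatively, as everywhere in MathComp: the
   identity 0 of the mathematical text is 1, and {0} is the trivial group 1. *)

Definition is_minimum (S : nat -> Prop) (m : nat) : Prop :=
  S m /\ forall k, S k -> m <= k.

Section QuasiUniformCode.

Variables (n : nat) (hT : 'I_n -> finGroupType).

Definition word : finType := {dffun forall i : 'I_n, hT i}.

Definition zero_word : word := [ffun i => 1].

Definition dist (c c' : word) : nat := #|[set i | c i != c' i]|.

Definition wt (c : word) : nat := #|[set i | c i != 1]|.

Definition is_min_distance (C : {set word}) : nat -> Prop :=
  is_minimum (fun d => exists c c',
    [/\ c \in C, c' \in C, c != c' & d = dist c c']).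

Definition is_min_weight (C : {set word}) : nat -> Prop :=
  is_minimum (fun d => exists c, [/\ c \in C, c != zero_word & d = wt c]).

Variables (gT : finGroupType) (G : {group gT}) (Gs : 'I_n -> {group gT}).

(* The empty \bigcap is the whole type gT; intersecting with G makes the value
   at A = set0 equal to G, and changes nothing elsewhere when each Gs i is a
   subgroup of G. *)
Definition subgroup_cap (A : {set 'I_n}) : {set gT} :=
  G :&: \bigcap_(i in A) Gs i.

Variable psi : forall i, {morphism (G / Gs i) >-> hT i}.

Definition codeword (g : gT) : word := [ffun i => psi i (coset (Gs i) g)].

Definition quasi_uniform_code : {set word} := [set codeword g | g in G].

End QuasiUniformCode.

(* Main.v *)
Require Import Defs.
From mathcomp Require Import all_boot all_fingroup.

Set Implicit Arguments.
Unset Strict Implicit.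
Unset Printing Implicit Defensive.

Local Open Scope group_scope.

(** For [g] in [G], let Z(g) be the set of indices [i] with [g] in [Gs i]. Since
each [psi i] is injective, the codewords of [g] and [h] agree at [i] exactly when
[g * h^-1] lies in [Gs i]. Two consequences follow. The code is linear, in the
sense that the distance between two codewords is the weight of the codeword of
[g * h^-1], so that minimum distance and minimum weight coincide
([dist_codeword]). And the codeword of [g] has weight n - #|Z(g)|
([wt_codeword]), and is zero only for [g = 1] because the [Gs i] intersect
trivially ([codeword_eq]).

It remains to maximize #|Z(g)| over the nontrivial [g] in [G]. The intersection of
[G] with the [Gs i], [i] in [A], contains [g] exactly when [A] is included in Z(g)
([mem_subgroup_cap]); hence it is nontrivial exactly when [A] is included in Z(g)
for some nontrivial [g], and the maximum of #|A| over such [A] is the maximum of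
#|Z(g)|. *)

Section Codewords.

Variables (n : nat) (gT : finGroupType).
Variables (G : {group gT}) (Gs : 'I_n -> {group gT}).

(** The set Z(g) of the indices of the subgroups that contain [g]. *)
Definition containing (g : gT) : {set 'I_n} := [set i | g \in Gs i].

Lemma mem_subgroup_cap (A : {set 'I_n}) g :
  (g \in subgroup_cap G Gs A) = (g \in G) && (A \subset containing g).
Proof.
rewrite inE; congr (_ && _); apply/bigcapP/subsetP => AZ i Ai.
  by rewrite inE AZ.
by have := AZ i Ai; rewrite inE.
Qed.

Lemma subgroup_cap_neq1P (A : {set 'I_n}) :
  reflect (exists g, [/\ g \in G, g != 1 & A \subset containing g])
          (subgroup_cap G Gs A != 1).
Proof.
have capE : subgroup_cap G Gs A = (G :&: \bigcap_(i in A) Gs i)%G by [].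
rewrite capE; apply: (iffP (trivgPn _)) => -[g]; rewrite -?capE.
  by rewrite mem_subgroup_cap => /andP[Gg AZ] g1; exists g.
by case=> Gg g1 AZ; exists g; rewrite -?capE ?mem_subgroup_cap ?Gg.
Qed.

Hypothesis nGsG : forall i, G \subset 'N(Gs i).
Hypothesis capGs : \bigcap_(i < n) Gs i = 1.

Variables (hT : 'I_n -> finGroupType).
Variable psi : forall i, {morphism (G / Gs i) >-> hT i}.
Hypothesis injpsi : forall i, 'injm (psi i).

Lemma codeword_coord_eq g h i : g \in G -> h \in G ->
  (codeword psi g i == codeword psi h i) = (g * h^-1 \in Gs i).
Proof.
move=> Gg Gh; have [Ng Nh] := (subsetP (nGsG i) g Gg, subsetP (nGsG i) h Gh).
rewrite !ffunE (inj_in_eq (injmP (injpsi i))) ?mem_quotient //.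
rewrite eq_mulgV1 -morphV // -morphM ?groupV //.
by apply/eqP/idP => [/coset_idr-> // | /coset_id //]; rewrite groupM ?groupV.
Qed.

Lemma codeword1 : codeword psi 1 = zero_word hT.
Proof. by apply/ffunP => i; rewrite !ffunE !morph1. Qed.

Lemma codeword_eq g h : g \in G -> h \in G ->
  (codeword psi g == codeword psi h) = (g == h).
Proof.
move=> Gg Gh; apply/eqP/eqP => [eq_gh | -> //].
apply/eqP; rewrite eq_mulgV1 -in_set1 -[[set 1]]capGs.
by apply/bigcapP => i _; rewrite -codeword_coord_eq // eq_gh.
Qed.

Lemma wt_codeword g : g \in G -> wt (codeword psi g) = (n - #|containing g|)%N.
Proof.
move=> Gg; rewrite /wt cardsCs card_ord; congr (n - _)%N; apply: eq_card => i.
have := codeword_coord_eq i Gg (group1 G).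
by rewrite codeword1 [zero_word hT i]ffunE invg1 mulg1 !inE negbK.
Qed.

Lemma dist_codeword g h : g \in G -> h \in G ->
  dist (codeword psi g) (codeword psi h) = wt (codeword psi (g * h^-1)).
Proof.
move=> Gg Gh; have Ggh : g * h^-1 \in G by rewrite groupM ?groupV.
rewrite wt_codeword // /dist cardsCs card_ord.
congr (n - _)%N; apply: eq_card => i.
by rewrite !inE negbK codeword_coord_eq.
Qed.

(** In a linear code, the distances between distinct words are the weights of
    the nonzero words. *)
Lemma is_min_distance_of_weight d :
  is_min_weight (quasi_uniform_code psi) d ->
  is_min_distance (quasi_uniform_code psi) d.
Proof.
case=> -[c [Cc c0 ->]] min_d; split=> [|k [c1 [c2 [/imsetP[g Gg ->]]]]].
  have /imsetP[g Gg Dc] := Cc; exists c, (zero_word hT); split=> //.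
    by rewrite -codeword1 imset_f.
  by rewrite -codeword1 Dc dist_codeword // invg1 mulg1.
case/imsetP=> h Gh -> neq_gh ->.
have Ggh : g * h^-1 \in G by rewrite groupM ?groupV.
apply: min_d; exists (codeword psi (g * h^-1)).
split; [exact: imset_f | | exact: dist_codeword].
by rewrite -codeword1 codeword_eq // -eq_mulgV1 -codeword_eq.
Qed.

Lemma is_min_weight_code : G :!=: 1 ->
  is_min_weight (quasi_uniform_code psi)
    (n - \max_(A : {set 'I_n} | subgroup_cap G Gs A != 1%g) #|A|)%N.
Proof.
move=> ntG; set P := fun A => subgroup_cap G Gs A != 1.
(* For nontrivial g, the index set Z(g) is itself among those maximized over. *)
have PZ g : g \in G -> g != 1 -> P (containing g).
  by move=> Gg g1; apply/subgroup_cap_neq1P; exists g.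
split=> [|w [c [/imsetP[g Gg ->] + ->]]].
  have [x Gx x1] := trivgPn _ ntG.
  have P_gt0 : 0 < #|P| by apply/card_gt0P; exists (containing x); apply: PZ.
  have [A PA maxA] := eq_bigmax_cond (fun A : {set 'I_n} => #|A|) P_gt0.
  have /subgroup_cap_neq1P[g [Gg g1 AZ]] : P A by [].
  exists (codeword psi g); split; first exact: imset_f.
    by rewrite -codeword1 codeword_eq.
  (* A is of maximal size and included in Z(g), so the two sizes agree. *)
  rewrite wt_codeword //; congr (n - _)%N; apply/eqP; rewrite eqn_leq.
  apply/andP; split; first by rewrite maxA subset_leq_card.
  apply: (leq_bigmax_cond (F := fun A : {set 'I_n} => #|A|)); exact: PZ.
rewrite -codeword1 codeword_eq // => g1; rewrite wt_codeword // leq_sub2l //.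
apply: (leq_bigmax_cond (F := fun A : {set 'I_n} => #|A|)); exact: PZ.
Qed.

End Codewords.

Theorem lemma3 (n : nat) (n_gt0 : 0 < n)
    (gT : finGroupType) (G : {group gT}) (Gs : 'I_n -> {group gT})
    (abG : abelian G) (ntG : G :!=: 1)
    (sGsG : forall i, Gs i \subset G)
    (capGs : \bigcap_(i < n) Gs i = 1)
    (hT : 'I_n -> finGroupType) (H : forall i, {group hT i})
    (abH : forall i, abelian (H i))
    (psi : forall i, {morphism (G / Gs i) >-> hT i})
    (psiP : forall i, isom (G / Gs i) (H i) (psi i)) :
  let C := quasi_uniform_code psi in
  let d := (n - \max_(A : {set 'I_n} | subgroup_cap G Gs A != 1%g) #|A|)%N in
  is_min_distance C d /\ is_min_weight C d.
Proof.
have nGsG i : G \subset 'N(Gs i) by apply: sub_abelian_norm.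
have injpsi i : 'injm (psi i) by apply: isom_inj (psiP i).
have min_wt := is_min_weight_code nGsG capGs injpsi ntG.
by split=> //; apply: is_min_distance_of_weight.
Qed.
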